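(* Let $R$ be a ring with unity $1\neq 0$ which is not a field, and let $M$ be a left module over $R$. Then the following are equivalent: (a) Every submodule of $M$ is a direct summand. (b) $M$ has no proper essential submodule. (c) $M$ is semisimple. (d) $\mathrm{Soc}(M)=M$.
   Context: A proper essential submodule of a module $M$ is a submodule $E$ of $M$ with $E\neq\{0_M\}$, $E\neq M$, such that $E\cap N\neq\{0_M\}$ for every nonzero submodule $N$ of $M$. A module is semisimple if it is a direct sum of simple submodules. $\mathrm{Soc}(M)$ denotes the socle of $M$, i.e. the sum of all simple submodules of $M$. *)

(* Defs.v *)
From HB Require Import structures.
From mathcomp Require Import all_boot all_algebra.
From mathcomp Require Import boolp classical_sets.

Set Implicit Arguments.
Unset Strict Implicit.
Unset Printing Implicit Defensive.

Import GRing.Theory.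
Local Open Scope classical_set_scope.
Local Open Scope ring_scope.

(* [R] carries no inverse operation, so being a field is a proposition. The
   condition 1 != 0 is part of [nzRingType]. *)
Definition is_field (R : nzRingType) : Prop :=
  commutative (@GRing.mul R) /\
  forall x : R, x != 0 -> exists y : R, y * x = 1.

Section Submodules.
Variables (R : nzRingType) (M : lmodType R).
Implicit Types N E S : set M.

Definition submodule N : Prop := submod_closed (mem N).

(* Finite sums of elements of [A]. When [A] is a union of submodules, this is
   the sum of these submodules; it is {0} for the empty union. *)
Definition sum_of (A : set M) : set M :=
  [set x | exists2 s : seq M,
     (forall y, y \in s -> A y) & x = \sum_(y <- s) y].

Definition direct_summand N : Prop :=
  submodule N /\
  exists N' : set M,
    [/\ submodule N', sum_of (N `|` N') = [set: M] & N `&` N' = [set 0]].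

Definition proper_essential E : Prop :=
  [/\ submodule E, E <> [set 0], E <> [set: M] &
      forall N, submodule N -> N <> [set 0] -> E `&` N <> [set 0]].

Definition simple_submodule S : Prop :=
  [/\ submodule S, S <> [set 0] &
      forall N, submodule N -> N `<=` S -> N = [set 0] \/ N = S].

(* Internal direct sum of a possibly infinite family. *)
Definition is_direct_sum (I : Type) (S : I -> set M) : Prop :=
  sum_of (\bigcup_i S i) = [set: M] /\
  forall i, S i `&` sum_of (\bigcup_(j in [set j | j <> i]) S j) = [set 0].

(* The zero module is the direct sum of the empty family. *)
Definition semisimple : Prop :=
  exists (I : Type) (S : I -> set M),
    (forall i, simple_submodule (S i)) /\ is_direct_sum S.

Definition Soc : set M :=
  sum_of (\bigcup_(S in [set S : set M | simple_submodule S]) S).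

End Submodules.

Arguments semisimple {R} M.
Arguments Soc {R} M.

(* Main.v *)
(** A submodule [K] maximal among those meeting [N] trivially makes [N + K]
    essential, so [N + K] is everything as soon as [M] has no proper essential
    submodule, or as soon as simple submodules, which every essential submodule
    contains, generate [M]. If every submodule is a summand and [x] lies outside
    the socle, a complement of a submodule [K] maximal among those containing the
    socle and avoiding [x] is simple: for a nontrivial decomposition [L + L'] of
    it, [x] would lie in [(K + L) `&` (K + L') = K]. This simple submodule lies in
    the socle, hence in [K], which is absurd. Finally, a maximal independent
    family of simple submodules generates the socle. *)
Require Import Defs.
From mathcomp Require Import all_boot all_algebra.
From mathcomp Require Import boolp classical_sets.

Import GRing.Theory.
Local Open Scope classical_set_scope.
Local Open Scope ring_scope.

(** Each entry of [s] is caught by some member of the chain; the largest of these finitely many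
    members and [X0] catches them all. Thus conditions on finite sums pass to unions of chains. [X0]
    also serves the empty list. *)
Lemma chain_finite_bound {T : Type} {I : eqType} (C : set (set T))
    (Q : set T -> set I) (X0 : set T) (s : seq I) :
  total_on C subset -> (forall X Y, X `<=` Y -> Q X `<=` Q Y) -> C X0 ->
  (forall y, y \in s -> exists2 X, C X & Q X y) ->
  exists X, [/\ C X, X0 `<=` X & forall y, y \in s -> Q X y].
Proof.
move=> Ctot Qmono CX0; elim: s => [_|z s IHs zsP]; first by exists X0; split.
have [y ys|X [CX X0X XQ]] := IHs; first by apply: zsP; rewrite inE ys orbT.
have [|Y CY YQ] := zsP z; first by rewrite inE eqxx.
have [XY|YX] := Ctot _ _ CX CY.
  exists Y; split=> // [|y]; first exact: subset_trans X0X XY.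
  by rewrite inE => /predU1P[->//|/XQ]; exact: (Qmono X Y XY).
exists X; split=> // y; rewrite inE => /predU1P[->|/XQ//].
exact: (Qmono Y X YX).
Qed.

(** * Submodules and their sums *)

Section Submodules.
Context {R : nzRingType} {M : lmodType R}.
Implicit Types (A B N K L S : set M) (F : set (set M)) (x y : M).

Lemma submoduleP N :
  submodule N <->
  N 0 /\ forall a x y, N x -> N y -> N (a *: x + y).
Proof.
split=> -[N0 Nlin]; split.
- by rewrite -in_setE.
- by move=> a x y Nx Ny; rewrite -in_setE; apply: Nlin; rewrite in_setE.
- by rewrite in_setE.
- by move=> a x y; rewrite !in_setE; apply: Nlin.
Qed.

Lemma submod0 {N} : submodule N -> N 0.
Proof. by move/submoduleP=> []. Qed.

Lemma submodD {N x y} : submodule N -> N x -> N y -> N (x + y).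
Proof. by move/submoduleP=> [_ Nl] Nx Ny; rewrite -[x]scale1r; apply: Nl. Qed.

Lemma submodZ {N} a {x} : submodule N -> N x -> N (a *: x).
Proof. by move/submoduleP=> [N0 Nl] Nx; rewrite -[_ *: _]addr0; apply: Nl. Qed.

Lemma submodB {N x y} : submodule N -> N x -> N y -> N (x - y).
Proof. by move=> sN Nx Ny; rewrite -scaleN1r; apply/submodD/submodZ. Qed.

Lemma submodI {N K} : submodule N -> submodule K -> submodule (N `&` K).
Proof.
move=> sN sK; apply/submoduleP; split=> [|a x y [Nx Kx] [Ny Ky]].
  by split; apply: submod0.
by split; apply: submodD => //; apply: submodZ.
Qed.

Lemma submodule_ne0 {N} : submodule N -> N <> [set 0] -> exists2 x, N x & x <> 0.
Proof.
move=> sN /eqP; apply: contra_neqP => Nno; apply/seteqP; split=> [x Nx|_ ->].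
  by apply: contrapT => x0; apply: Nno; exists x.
exact: submod0.
Qed.

Lemma submodI0P {N K} : submodule N -> submodule K ->
  N `&` K = [set 0] <-> forall x, N x -> K x -> x = 0.
Proof.
move=> sN sK; split=> [NK x Nx Kx|NK].
  by have : (N `&` K) x by []; rewrite NK.
apply/seteqP; split=> [x [Nx Kx]|_ ->]; first exact: NK.
exact: submod0 (submodI sN sK).
Qed.

Lemma sub_sum_of A : A `<=` sum_of A.
Proof.
by move=> x Ax; exists [:: x] => [y|]; rewrite ?big_seq1 // inE => /eqP->.
Qed.

Lemma sum_of_sub A N : submodule N -> A `<=` N -> sum_of A `<=` N.
Proof.
move=> sN AN _ [s sA ->]; rewrite big_seq; apply: big_ind => [|x y|y /sA/AN//].
  exact: submod0.
exact: submodD.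
Qed.

Lemma sum_ofS A B : A `<=` B -> sum_of A `<=` sum_of B.
Proof. by move=> AB x [s sA ->]; exists s => // y /sA/AB. Qed.

(** Concatenating lists gives closure under addition, so only scalars are checked on [A]. This suits
    unions of submodules, which need not be closed under addition. *)
Lemma sum_of_submodule A :
  (forall a x, A x -> A (a *: x)) -> submodule (sum_of A).
Proof.
move=> AZ; apply/submoduleP; split=> [|a _ _ [s sA ->] [t tA ->]].
  by exists [::]; rewrite ?big_nil.
exists ([seq a *: y | y <- s] ++ t) => [y|].
  by rewrite mem_cat => /orP[/mapP[z /sA Az ->]|/tA//]; apply: AZ.
by rewrite big_cat big_map scaler_sumr.
Qed.

Lemma sum_of_bigcup_submodule F :
  (forall S, F S -> submodule S) -> submodule (sum_of (\bigcup_(S in F) S)).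
Proof.
move=> sF; apply: sum_of_submodule => a x [S FS Sx].
by exists S => //; apply: submodZ => //; apply: sF.
Qed.

Lemma sum_ofUP {N K} : submodule N -> submodule K ->
  sum_of (N `|` K) = [set x | exists2 n, N n & exists2 k, K k & x = n + k].
Proof.
move=> sN sK; apply/seteqP; split=> [|_ [n Nn [k Kk ->]]].
  apply: sum_of_sub => [|x [Nx|Kx]].
  - apply/submoduleP; split=> [|a _ _ [n Nn [k Kk ->]] [n' Nn' [k' Kk' ->]]].
      by exists 0; [exact: submod0|exists 0; [exact: submod0|rewrite addr0]].
    exists (a *: n + n'); first by apply: submodD => //; apply: submodZ.
    exists (a *: k + k'); first by apply: submodD => //; apply: submodZ.
    by rewrite scalerDr addrACA.
  - by exists x => //; exists 0; rewrite ?addr0 //; exact: submod0.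
  - by exists 0; [exact: submod0|exists x; rewrite ?add0r].
exists [:: n; k]; last by rewrite big_cons big_seq1.
by move=> y; rewrite !inE => /orP[]/eqP->; [left|right].
Qed.

Lemma submodU {N K} : submodule N -> submodule K -> submodule (sum_of (N `|` K)).
Proof.
move=> sN sK; apply: sum_of_submodule => a x.
by case=> [Nx|Kx]; [left|right]; apply: submodZ.
Qed.

(** * Maximal submodules by Zorn's lemma *)

Lemma maximal_avoiding A B :
  submodule A -> A `&` B = set0 ->
  exists K, [/\ submodule K, A `<=` K, K `&` B = set0 &
    forall L, submodule L -> K `<=` L -> L `&` B = set0 -> L `<=` K].
Proof.
move=> sA AB.
(* Stated through [A `|` X] so that the union of the empty chain qualifies. *)
pose P X := submodule (A `|` X) /\ (A `|` X) `&` B = set0.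
have P0 : P set0 by rewrite /P setU0.
have [C CP Ctot|X [[sX XB] Xmax]] := @Zorn_bigcup M P.
  (* The chain may be empty; adjoining [set0] gives [chain_finite_bound] a starting member and
     accounts for the elements of [A]. *)
  have Ctot' : total_on (C `|` [set set0]) subset.
    by move=> X Y [CX|->] [CY|->]; [exact: Ctot|right|left|left].
  have bound (s : seq M) : (forall y, y \in s -> (A `|` \bigcup_(X in C) X) y) ->
      exists2 X, P X & (A `|` X `<=` A `|` \bigcup_(X in C) X) /\
                       forall y, y \in s -> (A `|` X) y.
    move=> sAC.
    have [| |y /sAC|X [CX _ sX]] := chain_finite_bound
      (C `|` [set set0]) (fun X => A `|` X) set0 s Ctot'.
    - by move=> X Y XY; exact: setUS.
    - by right.
    - case=> [Ay|[X CX Xy]]; last by exists X; [left|right].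
      by exists set0; [right|left].
    case: CX => [CX|XE].
      by exists X; [exact: CP|split=> //; apply: setUS; exact: bigcup_sup].
    by exists X; [rewrite XE|split=> //; rewrite XE; apply: setUS].
  split.
    apply/submoduleP; split=> [|a x y ACx ACy]; first by left; exact: submod0.
    have [z|X [sX _] [XC Xxy]] := bound [:: x; y].
      by rewrite !inE => /orP[]/eqP->.
    apply: XC; apply: submodD => //; last by apply: Xxy; rewrite !inE eqxx orbT.
    by apply: submodZ => //; apply: Xxy; rewrite !inE eqxx.
  rewrite -subset0 => x [ACx Bx].
  have [y|X [_ <-] [_ Xx]] := bound [:: x]; first by rewrite inE => /eqP->.
  by split=> //; apply: Xx; rewrite inE.
exists (A `|` X); split=> [//|x Ax|//|L sL KL LB]; first by left.
apply: contrapT => LK; apply: (Xmax L).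
  split; first by move=> x Xx; apply: KL; right.
  by move=> LX; apply: LK => x /LX; right.
by rewrite /P (_ : A `|` L = L) // setUidPr // => x Ax; apply: KL; left.
Qed.

(** Take [K] maximal among the submodules avoiding the nonzero elements of [N]. If [L] meets [N + K]
    trivially, then [K + L] still avoids them, so [L] lies in [K], hence in [N + K], and is zero. *)
Lemma disjoint_essential_complement N : submodule N ->
  exists K, [/\ submodule K, N `&` K = [set 0] &
    forall L, submodule L -> sum_of (N `|` K) `&` L = [set 0] -> L = [set 0]].
Proof.
move=> sN; pose N' : set M := [set x | N x /\ x <> 0].
have s0 : submodule ([set 0] : set M).
  by apply/submoduleP; split=> // a x y -> ->; rewrite scaler0 addr0.
have [|K [sK _ KN' Kmax]] := maximal_avoiding [set 0] N' s0.
  by rewrite -subset0 => x [-> []].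
have NK x : N x -> K x -> x = 0.
  move=> Nx Kx; apply: contrapT => x0.
  by have : (K `&` N') x by []; rewrite KN'.
exists K; split=> //; first exact/submodI0P.
have sNK := submodU sN sK.
move=> L sL /(submodI0P sNK sL) NKL.
have KsubU : K `<=` sum_of (N `|` K) by move=> x Kx; apply: sub_sum_of; right.
have LK : L `<=` K.
  have -/subset_trans-KLK : L `<=` sum_of (K `|` L).
    by move=> x Lx; apply: sub_sum_of; right.
  apply: KLK; apply: Kmax; first exact: submodU.
    by move=> x Kx; apply: sub_sum_of; left.
  rewrite -subset0 => x; rewrite (sum_ofUP sK sL) => -[[k Kk [l Ll xE]]] [Nx x0].
  have l0 : l = 0.
    apply: NKL => //; have -> : l = x - k by rewrite xE addrAC subrr add0r.
    by apply: submodB => //; [apply: sub_sum_of; left|exact: KsubU].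
  by apply: x0; apply: NK; rewrite // xE l0 addr0.
apply/seteqP; split=> [x Lx|_ ->]; last exact: submod0.
by apply: NKL => //; apply/KsubU/LK.
Qed.

(** * Summands and essential submodules *)

Lemma essential_of_summands :
  (forall N, submodule N -> direct_summand N) ->
  ~ exists E : set M, proper_essential E.
Proof.
move=> allsum [E [sE E0 ET Eess]].
have [_ [K [sK EKT EK0]]] := allsum _ sE.
apply: (Eess K) => // K0; apply: ET; rewrite -EKT.
apply/seteqP; split=> [x Ex|]; first by apply: sub_sum_of; left.
apply: sum_of_sub => // x [//|]; rewrite K0 => ->; exact: submod0.
Qed.

Lemma summands_of_essential :
  ~ (exists E : set M, proper_essential E) ->
  forall N, submodule N -> direct_summand N.
Proof.
move=> noess N sN; split=> //.
have [K [sK NK0 Kess]] := disjoint_essential_complement N sN.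
exists K; split=> //; apply: contrapT => NKT.
have sNK := submodU sN sK; apply: noess; exists (sum_of (N `|` K)); split=> //.
  (* If [N + K] were zero, the whole module would meet it trivially and so be zero too, whence
     [N + K] would be everything. *)
  move=> NKeq0; apply: NKT; rewrite NKeq0; apply/esym/Kess; last by rewrite setIT.
  by apply/submoduleP.
by move=> L sL L0 /(Kess L sL).
Qed.

(** * The socle *)

Lemma simple_meet S N : simple_submodule S -> submodule N ->
  N `&` S = [set 0] \/ S `<=` N.
Proof.
move=> [sS _ Smin] sN; have [] := Smin _ (submodI sN sS); first exact: subIsetr.
  by left.
by move=> NS; right; rewrite -NS; exact: subIsetl.
Qed.

Lemma Soc_submodule : submodule (Soc M).
Proof. by apply: sum_of_bigcup_submodule => S []. Qed.

Lemma sub_Soc S : simple_submodule S -> S `<=` Soc M.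
Proof. by move=> simS x Sx; apply: sub_sum_of; exists S. Qed.

Lemma Soc_sub N : submodule N ->
  (forall S, simple_submodule S -> S `<=` N) -> Soc M `<=` N.
Proof.
by move=> sN SN; apply: sum_of_sub => // x [S simS Sx]; exact: (SN S).
Qed.

Lemma summands_of_Soc :
  Soc M = [set: M] -> forall N, submodule N -> direct_summand N.
Proof.
move=> SocT N sN; split=> //.
have [K [sK NK0 Kess]] := disjoint_essential_complement N sN.
exists K; split=> //; rewrite -subTset -SocT.
have sNK := submodU sN sK; apply: Soc_sub => // S simS.
have [S0|//] := simple_meet S _ simS sNK.
by case: simS => sS + _; rewrite (Kess S).
Qed.

Lemma Soc_of_summands :
  (forall N, submodule N -> direct_summand N) -> Soc M = [set: M].
Proof.
move=> allsum; rewrite -subTset => x _; apply: contrapT => Socx.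
have [|K [sK SocK Kx Kmax]] := maximal_avoiding (Soc M) [set x] Soc_submodule.
  by rewrite -subset0 => y [+ yE]; rewrite yE.
have {Kx} nKx : ~ K x.
  by move=> Kx'; have : (K `&` [set x]) x by []; rewrite Kx.
have [_ [K' [sK' KK'T /(submodI0P sK sK') KK'0]]] := allsum _ sK.
(* By maximality of [K], the sum of [K] and a nonzero submodule of [K'] contains [x]. *)
have KLx L : submodule L -> L `<=` K' -> L <> [set 0] ->
    exists2 k, K k & exists2 l, L l & x = k + l.
  move=> sL LK' /(submodule_ne0 sL)[l Ll l0].
  suff : sum_of (K `|` L) x by rewrite (sum_ofUP sK sL).
  apply: contrapT => KLnx; apply: l0; apply: KK'0; last exact: LK'.
  apply: (Kmax (sum_of (K `|` L))); first exact: submodU.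
  - by move=> y Ky; apply: sub_sum_of; left.
  - by rewrite -subset0 => y [+ yE]; rewrite yE.
  - by apply: sub_sum_of; right.
have K'0 : K' <> [set 0].
  move=> K'0; have : sum_of (K `|` K') x by rewrite KK'T.
  by rewrite (sum_ofUP sK sK') K'0 => -[k Kk [_ -> xE]]; apply: nKx; rewrite xE addr0.
have simK' : simple_submodule K'.
  split=> // L sL LK'; apply: contrapT => /not_orP[L0 LneK'].
  have [_ [L'' [sL'' LLT /(submodI0P sL sL'') LL0]]] := allsum _ sL.
  (* By the modular law, the trace on [K'] of a complement of [L] in [M] is a complement of [L] in
     [K']. *)
  have sL' := submodI sL'' sK'.
  have [//|k Kk [l Ll xE]] := KLx L sL LK'.
  have [| |k' Kk' [l' [L''l' K'l'] xE']] := KLx _ sL'.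
  - exact: subIsetr.
  - move=> /(submodI0P sL'' sK') L'0; apply: LneK'.
    apply/seteqP; split=> // y K'y.
    have : sum_of (L `|` L'') y by rewrite LLT.
    rewrite (sum_ofUP sL sL'') => -[u Lu [v L''v yE]].
    have v0 : v = 0.
      apply: L'0 => //; have -> : v = y - u by rewrite yE addrAC subrr add0r.
      by apply: submodB => //; exact: LK'.
    by rewrite yE v0 addr0.
  (* Comparing [x = k + l] with [x = k' + l'], this difference lies in both [K] and [K'], so
     [l = l']; this element lies in both [L] and [L''], hence vanishes and [x = k]. *)
  have kk'E : k - k' = l' - l.
    by apply/eqP; rewrite subr_eq addrAC eq_sym subr_eq -xE addrC -xE'.
  have /KK'0 : K (k - k') by exact: submodB.
  rewrite kk'E => /(_ (submodB sK' K'l' (LK' _ Ll)))/subr0_eq l'E.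
  have l0 : l = 0 by apply: LL0; rewrite // -l'E.
  by apply: nKx; rewrite xE l0 addr0.
apply: K'0; apply/seteqP; split=> [y K'y|_ ->]; last exact: submod0.
by apply: KK'0 => //; apply: SocK; exact: (sub_Soc K').
Qed.

Lemma Soc_of_semisimple : semisimple M -> Soc M = [set: M].
Proof.
move=> [I [S [simS [ST _]]]]; rewrite -subTset -ST.
by apply: sum_ofS => x [i _ Six]; exists (S i) => //; exact: simS.
Qed.

(** * Decomposition into simple submodules *)

(** A set of submodules instead of an indexed family, so that Zorn's lemma applies to inclusion. *)
Definition independent_simples F :=
  (forall S, F S -> simple_submodule S) /\
  forall S, F S -> forall x, S x -> sum_of (\bigcup_(T in F `\ S) T) x -> x = 0.

Lemma maximal_independent_simples :
  exists F, independent_simples F /\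
    forall G, F `<` G -> ~ independent_simples G.
Proof.
apply: Zorn_bigcup => C CP Ctot; split=> [S [F CF FS]|S [F CF FS] x Sx [s sC xE]].
  by have [+ _] := CP F CF; apply.
(* The finite sum giving [x] already lives in one member [G] of the chain; starting from [F] ensures
   that [G] contains [S]. *)
have [| |y /sC[T [[G CG GT] TS] Ty]|G [CG FG sG]] :=
  chain_finite_bound C (fun G => \bigcup_(T in G `\ S) T) F s Ctot.
- move=> X Y XY; apply: bigcup_subset; exact: setSD.
- exact: CF.
- by exists G => //; exists T.
have [_ Gind] := CP G CG.
by apply: (Gind S (FG _ FS) x Sx); exists s.
Qed.

Lemma semisimple_of_Soc : Soc M = [set: M] -> semisimple M.
Proof.
move=> SocT; have [F [[simF indF] Fmax]] := maximal_independent_simples.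
have subF S : F S -> submodule S by move=> /simF[].
pose U := sum_of (\bigcup_(S in F) S).
have sU : submodule U by exact: sum_of_bigcup_submodule.
have UT : U = [set: M].
  rewrite -subTset -SocT; apply: Soc_sub => // S simS.
  have sS : submodule S by case: simS.
  have [/(submodI0P sU sS) US0|//] := simple_meet S U simS sU.
  exfalso; have FS : ~ F S.
    move=> FS; case: simS => _ + _; apply; apply/seteqP.
    split=> [x Sx|_ ->]; last exact: submod0.
    by apply: US0 => //; apply: sub_sum_of; exists S.
  (* A simple [S] meeting [U] trivially could be added to [F] without losing independence. *)
  apply: (Fmax (F `|` [set S])); first split.
  - exact: subsetUl.
  - by move=> FSF; apply: FS; apply: FSF; right.
  split=> [T [/simF//|->//]|T [FT|->] x Tx xsum].
  - have sFT : submodule (sum_of (\bigcup_(V in F `\ T) V)).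
      by apply: sum_of_bigcup_submodule => V [/subF].
    have : sum_of (sum_of (\bigcup_(V in F `\ T) V) `|` S) x.
      apply: sum_ofS xsum => y [V [[FV|->] VT] Vy]; last by right.
      by left; apply: sub_sum_of; exists V.
    rewrite (sum_ofUP sFT sS) => -[u uF [v Sv xE]].
    (* Both [x] and [u] lie in [U], so the component [v] in [S] vanishes and the relation involves
       [F] alone. *)
    have v0 : v = 0.
      apply: US0 => //; have -> : v = x - u by rewrite xE addrAC subrr add0r.
      apply: submodB => //; first by apply: sub_sum_of; exists T.
      by apply: sum_ofS uF; apply: bigcup_subset; exact: subDsetl.
    by apply: (indF T FT x Tx); rewrite xE v0 addr0.
  - apply: US0 => //; apply: sum_ofS xsum => y [V [[FV|VE] VS] Vy].
      by exists V.
    by case: VS.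
exists {S : set M | F S}, sval; split=> [[S FS]|]; first exact: simF.
split=> [|[S FS] /=].
  rewrite -UT /U; congr sum_of; apply/seteqP.
  split=> [x [[S FS] _ Sx]|x [S FS Sx]]; first by exists S.
  by exists (exist _ S FS).
apply/seteqP; split=> [x [Sx xsum]|_ ->].
  apply: (indF S FS x Sx); apply: sum_ofS xsum => y [[T FT] /= TS Ty].
  exists T => //; split=> //= TE; apply: TS.
  (* Indices carry membership proofs; proof irrelevance makes distinct indices give distinct
     submodules. *)
  by move: FT Ty; rewrite TE => FT _; congr exist; exact: Prop_irrelevance.
split; first exact: submod0 (subF S FS).
by exists [::]; rewrite ?big_nil.
Qed.

End Submodules.

Theorem theorem1p3 (R : nzRingType) (hR : ~ is_field R) (M : lmodType R) :
  [<-> (forall N : set M, submodule N -> direct_summand N);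
       ~ (exists E : set M, proper_essential E);
       semisimple M;
       Soc M = [set: M]%classic].
Proof.
tfae.
- exact: essential_of_summands.
(* From (b) to (c) by way of (a) and (d). *)
- by move/summands_of_essential/Soc_of_summands/semisimple_of_Soc.
- exact: Soc_of_semisimple.
- exact: summands_of_Soc.
Qed.
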